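(* Let $K$ be a commutative ring with identity, $M$ a (not necessarily commutative) binoid, $A$ a $K$-algebra, and $\varphi:M\to A$ a binoid homomorphism into the multiplicative binoid $(A,\cdot,1,0)$. Then there is a unique $K$-algebra homomorphism $\phi:K[M]\to A$ with $\phi\circ\iota=\varphi$, where $\iota:M\to K[M]$, $a\mapsto T^a$ (and $\infty\mapsto 0$). In particular, for $A=K$ one has an isomorphism of semigroups $\hom(M,K)\cong \operatorname{Hom}_{K\text{-alg}}(K[M],K)$, where $\hom(M,K)$ is the set of binoid homomorphisms $M\to(K,\cdot,1,0)$ (the $K$-spectrum of $M$).
   Context: A binoid (written additively) is a monoid $(M,+,0)$ possessing an absorbing element $\infty$, i.e. $a+\infty=\infty+a=\infty$ for all $a\in M$. A binoid homomorphism is a monoid homomorphism sending $\infty$ to $\infty$. A $K$-algebra is a not necessarily commutative ring $A$ with identity together with a ring homomorphism $K\to A$ (preserving the identity) whose image lies in the center of $A$; it is regarded as a binoid $(A,\cdot,1,0)$ with identity element $1$ and absorbing element $0$. The binoid algebra is $K[M]=KM/(T^\infty)$, where $KM$ is the monoid algebra with $K$-basis $T^a$, $a\in M$; equivalently $K[M]$ is the free $K$-module on $T^a$, $a\in M\setminus\{\infty\}$, with $T^aT^b=T^{a+b}$ if $a+b\neq\infty$ and $T^aT^b=0$ otherwise. The set $\hom(M,K)$ is a semigroup under pointwise multiplication in $K$; $\operatorname{Hom}_{K\text{-alg}}(K[M],K)$ is a semigroup by $(\phi\psi)(T^a)=\phi(T^a)\psi(T^a)$ for $a\in M$, extended $K$-linearly.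 *)

(* Defs.v *)
From HB Require Import structures.
From mathcomp Require Import finmap monalg.
From mathcomp Require Import all_boot all_algebra boolp.

Set Implicit Arguments.
Unset Strict Implicit.
Unset Printing Implicit Defensive.

Import GRing.Theory.
Local Open Scope ring_scope.

(* A binoid extends the library's (not necessarily commutative) monoids, which
   are written multiplicatively: in additive notation, (1 : M)%g is the neutral
   element 0 and (a * b)%g is a + b. *)
HB.mixin Record Monoid_isBinoid M of monoid.Monoid M := {
  binfty : M;
  binfty_mull : left_zero binfty (@monoid.mul M);
  binfty_mulr : right_zero binfty (@monoid.mul M)
}.

#[short(type="binoidType")]
HB.structure Definition Binoid := {M of Monoid_isBinoid M & monoid.Monoid M}.

Arguments binfty {s}.
Notation "\infty" := binfty : group_scope.

HB.mixin Record isInftyMorphism (M N : binoidType) (f : M -> N) := {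
  bmorph_infty : f \infty%g = \infty%g
}.

HB.structure Definition BinoidMorphism (M N : binoidType) :=
  {f of @monoid.UMagmaMorphism M N f & isInftyMorphism M N f}.

Notation "{ 'binoid' M -> N }" := (BinoidMorphism.type M N)
  (at level 0, M at level 98, N at level 99,
   format "{ 'binoid'  M  ->  N }") : type_scope.

(* The binoid (R, *, 1, 0) of a ring. *)
Definition mulbinoid (R : pzRingType) : Type := R.

HB.instance Definition _ (R : pzRingType) := Choice.on (mulbinoid R).
HB.instance Definition _ (R : pzRingType) :=
  isMonoid.Build (mulbinoid R) (@mulrA R) (@mul1r R) (@mulr1 R).
HB.instance Definition _ (R : pzRingType) :=
  Monoid_isBinoid.Build (mulbinoid R) (@mul0r R) (@mulr0 R).

(* The library's algType only covers nonzero rings; here A may be zero, which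
   is needed because K[M] is zero when K = 0 or when M is trivial. *)
HB.mixin Record PzRing_isKAlgebra (K : comPzRingType) A of GRing.PzRing A := {
  structmap : {rmorphism K -> A};
  structmapC : forall (k : K) (x : A), structmap k * x = x * structmap k
}.

#[short(type="kalgType")]
HB.structure Definition KAlgebra (K : comPzRingType) :=
  {A of PzRing_isKAlgebra K A & GRing.PzRing A}.

Arguments structmap {K s}.

HB.mixin Record isStructMorphism (K : comPzRingType) (A B : kalgType K)
    (f : A -> B) := {
  smorph_struct : forall k : K, f (structmap k) = structmap k
}.

HB.structure Definition KAlgMorphism (K : comPzRingType) (A B : kalgType K) :=
  {f of @GRing.RMorphism A B f & isStructMorphism K A B f}.

Notation "{ 'kalg' A -> B }" := (KAlgMorphism.type A B)
  (at level 0, A at level 98, B at level 99,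
   format "{ 'kalg'  A  ->  B }") : type_scope.

HB.instance Definition _ (K : comPzRingType) :=
  PzRing_isKAlgebra.Build K K^o (structmap := idfun) (fun k x : K => mulrC k x).

Definition nonabs (M : binoidType) : Type := {a : M | a != \infty%g}.

HB.instance Definition _ (M : binoidType) := SubChoice.on (nonabs M).

(* K[M]: the free K-module on M \ {\infty}. *)
Definition binalg (K : comPzRingType) (M : binoidType) : Type :=
  {malg K[nonabs M]}.

HB.instance Definition _ (K : comPzRingType) (M : binoidType) :=
  GRing.Zmodule.on (binalg K M).

Section BinoidAlgebra.
Context (K : comPzRingType) (M : binoidType).
Implicit Types (x y z : binalg K M) (k l : K) (a b c : M).

(* k T^a, where T^\infty = 0 *)
Definition bmonom k a : binalg K M :=
  if insub a is Some a' then << k *g (a' : nonabs M) >> else 0.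

Definition binalg_one : binalg K M := bmonom 1 1%g.

Definition binalg_mul x y : binalg K M :=
  \sum_(a <- msupp x) \sum_(b <- msupp y) bmonom (x@_a * y@_b) (val a * val b)%g.

Lemma bmonomD a : {morph (bmonom^~ a) : k l / k + l}.
Proof.
move=> k l; rewrite /bmonom; case: insubP => [a' _ _|_]; last by rewrite addr0.
exact: monalgUD.
Qed.

Lemma bmonom0 a : bmonom 0 a = 0.
Proof. by apply: (@addrI _ (bmonom 0 a)); rewrite -bmonomD !addr0. Qed.

Lemma bmonom_infty k : bmonom k \infty%g = 0.
Proof. by rewrite /bmonom insubF ?eqxx. Qed.

Lemma bmonom_val k (a : nonabs M) : bmonom k (val a) = << k *g a >>.
Proof. by rewrite /bmonom valK. Qed.

Lemma binalg_ind (P : binalg K M -> Prop) :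
  P 0 -> (forall x y, P x -> P y -> P (x + y)) ->
  (forall k a, P (bmonom k a)) -> forall x, P x.
Proof.
move=> P0 PD Pm x; rewrite [x]monalgE; elim/big_ind: _ => // a _.
by rewrite -bmonom_val.
Qed.

Section Extension.
Context (V : zmodType) (h : K -> M -> V).
Hypothesis hD : forall a, {morph (h^~ a) : k l / k + l}.

Definition bext x : V := \sum_(a <- msupp x) h x@_a (val a).

Let h0 a : h 0 a = 0.
Proof. by apply: (@addrI _ (h 0 a)); rewrite -hD !addr0. Qed.

Let bextw (d : {fset nonabs M}) x : (msupp x `<=` d)%fset ->
  bext x = \sum_(a <- d) h x@_a (val a).
Proof.
move=> sd; apply: big_fset_incl => // a _ /mcoeff_outdom ->; exact: h0.
Qed.

Lemma bext_add : {morph bext : x y / x + y}.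
Proof.
move=> x y; rewrite (@bextw (msupp x `|` msupp y)%fset); last exact: msuppD_le.
rewrite (@bextw _ x (fsubsetUl _ (msupp y))).
rewrite (@bextw _ y (fsubsetUr (msupp x) _)) -big_split /=.
by apply: eq_bigr => a _; rewrite mcoeffD hD.
Qed.

Lemma bext0 : bext 0 = 0.
Proof. by apply: (@addrI _ (bext 0)); rewrite -bext_add !addr0. Qed.

Lemma bext_monom k a : h k \infty%g = 0 -> bext (bmonom k a) = h k a.
Proof.
rewrite /bmonom; case: insubP => [a' _ <- _|]; last first.
  by rewrite negbK => /eqP -> ->; rewrite bext0.
by rewrite (@bextw _ _ msuppU_le) big_seq_fset1 mcoeffUU.
Qed.

End Extension.

Lemma binalg_mulE x y : binalg_mul x y =
  bext (fun k a => bext (fun l b => bmonom (k * l) (a * b)%g) y) x.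
Proof. by []. Qed.

Let hr k a b : {morph (fun l => bmonom (k * l) (a * b)%g) : l l' / l + l'}.
Proof. by move=> l l'; rewrite mulrDr bmonomD. Qed.

Let hl y a : {morph (fun k => bext (fun l b => bmonom (k * l) (a * b)%g) y)
   : k k' / k + k'}.
Proof.
move=> k k'; rewrite /bext -big_split /=; apply: eq_bigr => b _.
by rewrite mulrDl bmonomD.
Qed.

Fact binalg_mulDl : left_distributive binalg_mul +%R.
Proof. by move=> x y z; rewrite !binalg_mulE bext_add. Qed.

Fact binalg_mulDr : right_distributive binalg_mul +%R.
Proof.
move=> x y z; rewrite !binalg_mulE /bext -big_split /=.
by apply: eq_bigr => a _; exact: (bext_add (hr _ _)).
Qed.

Fact binalg_mul0l y : binalg_mul 0 y = 0.
Proof. by rewrite binalg_mulE bext0. Qed.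

Fact binalg_mul0r x : binalg_mul x 0 = 0.
Proof.
by apply: (@addrI _ (binalg_mul x 0)); rewrite -binalg_mulDr !addr0.
Qed.

Fact binalg_mul_monom k l a b :
  binalg_mul (bmonom k a) (bmonom l b) = bmonom (k * l) (a * b)%g.
Proof.
rewrite binalg_mulE bext_monom //.
  by rewrite bext_monom // binfty_mulr bmonom_infty.
by rewrite /bext big1 // => c _; rewrite binfty_mull bmonom_infty.
Qed.

Fact binalg_mulA : associative binalg_mul.
Proof.
move=> x y z; elim/binalg_ind: x => [|x x' Ix Ix'|k a].
- by rewrite !binalg_mul0l.
- by rewrite !binalg_mulDl Ix Ix'.
elim/binalg_ind: y => [|y y' Iy Iy'|l b].
- by rewrite binalg_mul0r !binalg_mul0l binalg_mul0r.
- by rewrite binalg_mulDl !binalg_mulDr binalg_mulDl Iy Iy'.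
elim/binalg_ind: z => [|z z' Iz Iz'|m c].
- by rewrite !binalg_mul0r.
- by rewrite !binalg_mulDr Iz Iz'.
by rewrite !binalg_mul_monom mulrA mulgA.
Qed.

Fact binalg_mul1l : left_id binalg_one binalg_mul.
Proof.
elim/binalg_ind => [|x y Ix Iy|k a]; first exact: binalg_mul0r.
  by rewrite binalg_mulDr Ix Iy.
by rewrite binalg_mul_monom mul1r mul1g.
Qed.

Fact binalg_mul1r : right_id binalg_one binalg_mul.
Proof.
elim/binalg_ind => [|x y Ix Iy|k a]; first exact: binalg_mul0l.
  by rewrite binalg_mulDl Ix Iy.
by rewrite binalg_mul_monom mulr1 mulg1.
Qed.

HB.instance Definition _ := GRing.Zmodule_isPzRing.Build (binalg K M)
  binalg_mulA binalg_mul1l binalg_mul1r binalg_mulDl binalg_mulDr.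

Lemma bmonomM k l a b : bmonom k a * bmonom l b = bmonom (k * l) (a * b)%g.
Proof. exact: binalg_mul_monom. Qed.

Definition binalg_struct k : binalg K M := bmonom k 1%g.

Fact binalg_struct_nmod : nmod_morphism binalg_struct.
Proof. by split; [exact: bmonom0 | exact: bmonomD]. Qed.

Fact binalg_struct_monoid : GRing.monoid_morphism binalg_struct.
Proof.
by split=> [|k l]; rewrite /binalg_struct // bmonomM mulg1.
Qed.

HB.instance Definition _ :=
  GRing.isNmodMorphism.Build K (binalg K M) binalg_struct binalg_struct_nmod.
HB.instance Definition _ :=
  GRing.isMonoidMorphism.Build K (binalg K M) binalg_struct
    binalg_struct_monoid.

Fact binalg_structC k x : binalg_struct k * x = x * binalg_struct k.
Proof.
elim/binalg_ind: x => [|x y Ix Iy|l a]; first by rewrite mulr0 mul0r.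
  by rewrite mulrDr mulrDl Ix Iy.
by rewrite !bmonomM mulg1 mul1g mulrC.
Qed.

HB.instance Definition _ :=
  PzRing_isKAlgebra.Build K (binalg K M) binalg_structC.

(* T^a *)
Definition biota a : binalg K M := bmonom 1 a.

Lemma bmonomE k a : bmonom k a = structmap k * biota a.
Proof. by rewrite /structmap /= bmonomM mulr1 mul1g. Qed.

Section LinearExtension.
Context (A : kalgType K).

(* the K-linear map K[M] -> A sending T^a to g a for all a != \infty *)
Definition linext (g : M -> A) x : A :=
  \sum_(a <- msupp x) structmap x@_a * g (val a).

Context (f : {binoid M -> mulbinoid A}).

Let hD a : {morph (fun k : K => (structmap k : A) * f a) : k l / k + l}.
Proof. by move=> k l; rewrite rmorphD mulrDl. Qed.

Lemma linext_monom k a : linext f (bmonom k a) = structmap k * f a.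
Proof.
apply: (bext_monom hD); rewrite bmorph_infty.
exact: mulr0.
Qed.

Lemma linext_biota a : linext f (biota a) = f a.
Proof. by rewrite linext_monom rmorph1 mul1r. Qed.

Lemma linext_nmod : nmod_morphism (linext f).
Proof. by split; [exact: (bext0 hD) | exact: (bext_add hD)]. Qed.

Lemma linext_monoid : GRing.monoid_morphism (linext f).
Proof.
have [L0 LD] := linext_nmod.
split; first by rewrite -[1]/(biota 1%g) linext_biota gmulf1.
move=> x y; elim/binalg_ind: x => [|x x' Ix Ix'|k a].
- by rewrite mul0r L0 mul0r.
- by rewrite mulrDl !LD Ix Ix' mulrDl.
elim/binalg_ind: y => [|y y' Iy Iy'|l b].
- by rewrite mulr0 L0 mulr0.
- by rewrite mulrDr !LD Iy Iy' mulrDr.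
rewrite bmonomM !linext_monom rmorphM gmulfM.
rewrite -[(f a * f b)%g]/((f a : A) * (f b : A)) -!mulrA; congr (_ * _).
by rewrite !mulrA structmapC.
Qed.

Lemma linext_struct k : linext f (structmap k) = structmap k.
Proof. by rewrite linext_monom gmulf1; exact: mulr1. Qed.

HB.instance Definition _ :=
  GRing.isNmodMorphism.Build (binalg K M) A (linext f) linext_nmod.
HB.instance Definition _ :=
  GRing.isMonoidMorphism.Build (binalg K M) A (linext f) linext_monoid.
HB.instance Definition _ :=
  isStructMorphism.Build K (binalg K M) A (linext f) linext_struct.

End LinearExtension.
End BinoidAlgebra.

Arguments biota K {M} a.

Lemma binoid_hom_ext (M N : binoidType) (f g : {binoid M -> N}) :
  f =1 g -> f = g.
Proof.
case: f g => [f [[f1] [fM] [fi]]] [g [[g1] [gM] [gi]]] /= /funext fg.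
subst g.
by rewrite (Prop_irrelevance f1 g1) (Prop_irrelevance fM gM)
           (Prop_irrelevance fi gi).
Qed.

Lemma kalg_hom_ext (K : comPzRingType) (A B : kalgType K) (f g : {kalg A -> B}) :
  f =1 g -> f = g.
Proof.
case: f g => [f [[f1] [fM] [fi]]] [g [[g1] [gM] [gi]]] /= /funext fg.
subst g.
by rewrite (Prop_irrelevance f1 g1) (Prop_irrelevance fM gM)
           (Prop_irrelevance fi gi).
Qed.

HB.instance Definition _ (M N : binoidType) := gen_eqMixin {binoid M -> N}.
HB.instance Definition _ (M N : binoidType) := gen_choiceMixin {binoid M -> N}.
HB.instance Definition _ (K : comPzRingType) (A B : kalgType K) :=
  gen_eqMixin {kalg A -> B}.
HB.instance Definition _ (K : comPzRingType) (A B : kalgType K) :=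
  gen_choiceMixin {kalg A -> B}.

Section Semigroups.
Context (K : comPzRingType) (M : binoidType).

Definition pointwise_mul (f g : M -> K) : M -> mulbinoid K :=
  fun a => f a * g a.

Section PointwiseMul.
Context (f g : {binoid M -> mulbinoid K}).

Fact pointwise_mulM :
  {morph pointwise_mul f g : a b / (a * b)%g >-> (a * b)%g}.
Proof. by move=> a b; rewrite /pointwise_mul !gmulfM; exact: mulrACA. Qed.

Fact pointwise_mul1 : pointwise_mul f g 1%g = 1%g.
Proof. by rewrite /pointwise_mul !gmulf1; exact: mulr1. Qed.

Fact pointwise_mul_infty : pointwise_mul f g \infty%g = \infty%g.
Proof. by rewrite /pointwise_mul !bmorph_infty; exact: mulr0. Qed.

HB.instance Definition _ := monoid.isMultiplicative.Build
  M (mulbinoid K) (pointwise_mul f g) pointwise_mulM.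
HB.instance Definition _ := Multiplicative_isUMagmaMorphism.Build
  M (mulbinoid K) (pointwise_mul f g) pointwise_mul1.
HB.instance Definition _ := isInftyMorphism.Build
  M (mulbinoid K) (pointwise_mul f g) pointwise_mul_infty.

Definition binoid_hom_mul : {binoid M -> mulbinoid K} := pointwise_mul f g.

End PointwiseMul.

Fact binoid_hom_mulA : associative binoid_hom_mul.
Proof. by move=> f g h; apply: binoid_hom_ext => a; exact: mulrA. Qed.

HB.instance Definition _ :=
  isSemigroup.Build {binoid M -> mulbinoid K} binoid_hom_mulA.

Section KAlgHomMul.
Context (phi psi : {kalg binalg K M -> K^o}).

Definition biota_mul : M -> mulbinoid K :=
  fun a => phi (biota K a) * psi (biota K a).

Fact biota_mulM : {morph biota_mul : a b / (a * b)%g >-> (a * b)%g}.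
Proof.
move=> a b; have iM : biota K (a * b)%g = biota K a * biota K b.
  by rewrite /biota bmonomM mulr1.
by rewrite /biota_mul iM !rmorphM; exact: mulrACA.
Qed.

Fact biota_mul1 : biota_mul 1%g = 1%g.
Proof. by rewrite /biota_mul -[biota K 1%g]/(1 : binalg K M) !rmorph1; exact: mulr1. Qed.

Fact biota_mul_infty : biota_mul \infty%g = \infty%g.
Proof. by rewrite /biota_mul /biota bmonom_infty !rmorph0; exact: mulr0. Qed.

HB.instance Definition _ := monoid.isMultiplicative.Build
  M (mulbinoid K) biota_mul biota_mulM.
HB.instance Definition _ := Multiplicative_isUMagmaMorphism.Build
  M (mulbinoid K) biota_mul biota_mul1.
HB.instance Definition _ := isInftyMorphism.Build
  M (mulbinoid K) biota_mul biota_mul_infty.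

(* T^a |-> phi(T^a) psi(T^a), extended K-linearly *)
Definition kalg_hom_mul : {kalg binalg K M -> K^o} :=
  linext (biota_mul : {binoid M -> mulbinoid K^o}).

Lemma kalg_hom_mulE a :
  kalg_hom_mul (biota K a) = phi (biota K a) * psi (biota K a).
Proof. exact: linext_biota. Qed.

End KAlgHomMul.

Lemma kalg_hom_biota_ext (A : kalgType K) (phi psi : {kalg binalg K M -> A}) :
  phi \o biota K =1 psi \o biota K -> phi = psi.
Proof.
move=> eqi; apply: kalg_hom_ext; elim/binalg_ind => [|x y Ix Iy|k a].
- by rewrite !rmorph0.
- by rewrite !rmorphD /= Ix Iy.
by rewrite bmonomE !rmorphM /= !smorph_struct; have /= -> := eqi a.
Qed.

Fact kalg_hom_mulA : associative kalg_hom_mul.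
Proof.
move=> f g h; apply: kalg_hom_biota_ext => a /=.
by rewrite !kalg_hom_mulE mulrA.
Qed.

HB.instance Definition _ :=
  isSemigroup.Build {kalg binalg K M -> K^o} kalg_hom_mulA.

End Semigroups.

Definition semigroup_isomorphism (G H : semigroupType) (F : G -> H) : Prop :=
  {morph F : x y / (x * y)%g >-> (x * y)%g} /\ bijective F.

(* Main.v *)
Require Import Defs.
From HB Require Import structures.
From mathcomp Require Import all_boot all_algebra.

Import GRing.Theory.

(** The elements T^a span K[M] over K, so a K-algebra homomorphism is determined by its values on
    them ([kalg_hom_biota_ext]). Conversely, the K-linear extension [linext f] of a binoid
    homomorphism is a K-algebra homomorphism. Hence [kalg_lift] and [kalg_restr] are mutually
    inverse; for A = K both semigroup products are computed pointwise on the T^a, so lifting is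
    multiplicative. *)

Section Restriction.
Context (K : comPzRingType) (M : binoidType) (A : kalgType K).
Context (phi : {kalg binalg K M -> A}).

Definition biota_restr : M -> mulbinoid A := fun a => phi (biota K a).

Fact biota_restrM : {morph biota_restr : a b / (a * b)%g >-> (a * b)%g}.
Proof.
(* The product of [mulbinoid A] is by conversion the ring product of [A], which lets [rmorphM]
   apply. *)
move=> a b; rewrite /biota_restr -[RHS]/(phi _ * phi _)%R -rmorphM.
by rewrite /biota bmonomM mulr1.
Qed.

Fact biota_restr1 : biota_restr 1%g = 1%g.
(* T^0 is by definition the unit of K[M]. *)
Proof. exact: (rmorph1 phi). Qed.

Fact biota_restr_infty : biota_restr \infty%g = \infty%g.
Proof. by rewrite /biota_restr /biota bmonom_infty rmorph0. Qed.

HB.instance Definition _ := monoid.isMultiplicative.Build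
  M (mulbinoid A) biota_restr biota_restrM.
HB.instance Definition _ := Multiplicative_isUMagmaMorphism.Build
  M (mulbinoid A) biota_restr biota_restr1.
HB.instance Definition _ := isInftyMorphism.Build
  M (mulbinoid A) biota_restr biota_restr_infty.

Definition kalg_restr : {binoid M -> mulbinoid A} := biota_restr.

End Restriction.

Definition kalg_lift (K : comPzRingType) (M : binoidType) (A : kalgType K)
  (f : {binoid M -> mulbinoid A}) : {kalg binalg K M -> A} := linext f.

Lemma kalg_lift_biota (K : comPzRingType) (M : binoidType) (A : kalgType K)
  (f : {binoid M -> mulbinoid A}) : kalg_lift K M A f \o biota K =1 f.
Proof. by move=> a; exact: linext_biota. Qed.

Lemma kalg_liftK (K : comPzRingType) (M : binoidType) (A : kalgType K) :
  cancel (kalg_lift K M A) (kalg_restr K M A).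
Proof. by move=> f; apply: binoid_hom_ext => a; exact: kalg_lift_biota. Qed.

Lemma kalg_restrK (K : comPzRingType) (M : binoidType) (A : kalgType K) :
  cancel (kalg_restr K M A) (kalg_lift K M A).
Proof.
by move=> phi; apply: kalg_hom_biota_ext => a; exact: kalg_lift_biota.
Qed.

(** It suffices to compare values at each T^a, where both sides give f(a)g(a). The type ascription
    selects [mulbinoid K], on which the semigroup structure is declared, over the convertible
    [mulbinoid K^o]. *)
Lemma kalg_liftM (K : comPzRingType) (M : binoidType) :
  {morph (kalg_lift K M K^o : {binoid M -> mulbinoid K} -> _)
     : f g / (f * g)%g >-> (f * g)%g}.
Proof.
move=> f g; apply: kalg_hom_biota_ext => a.
rewrite kalg_lift_biota /= kalg_hom_mulE.
by have /= -> := kalg_lift_biota K M K^o f a;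
   have /= -> := kalg_lift_biota K M K^o g a.
Qed.

Theorem proposition3p2p3 (K : comPzRingType) (M : binoidType) :
  (forall (A : kalgType K) (f : {binoid M -> mulbinoid A}),
     exists! phi : {kalg binalg K M -> A}, phi \o biota K =1 f)
  /\
  (exists F : {binoid M -> mulbinoid K} -> {kalg binalg K M -> K^o},
     semigroup_isomorphism F
     /\ (forall f : {binoid M -> mulbinoid K}, F f \o biota K =1 f)).
Proof.
split=> [A f|].
  exists (kalg_lift K M A f); split; first exact: kalg_lift_biota.
  (* Uniqueness: [psi] and the lift both send T^a to f(a). *)
  by move=> psi psiE; apply: kalg_hom_biota_ext => a;
     rewrite kalg_lift_biota psiE.
exists (kalg_lift K M K^o); split; last exact: (kalg_lift_biota K M K^o).
split; first exact: kalg_liftM.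
exists (kalg_restr K M K^o); [exact: kalg_liftK | exact: kalg_restrK].
Qed.
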